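(* Let $s\in(0,1]$ and let $(r_k)_{k\in\mathbb{N}}\subset\mathbb{R}$ be a sequence of real numbers. Then there exists a nonempty Ahlfors $s$-regular set $E\subset\mathbb{R}^2$ such that \[ \overline{\dim}_B\,\pi_{r_k}(E)<s\quad\text{for all } k\in\mathbb{N}. \]
   Context: For $r\in\mathbb{R}$, $\pi_r:\mathbb{R}^2\to\mathbb{R}$ is defined by $\pi_r(x,y)=x+ry$. A closed set $E\subset\mathbb{R}^d$ is called Ahlfors $s$-regular ($s>0$) if there are a Radon measure $\mu$ with $\operatorname{spt}\mu=E$ and a constant $C>0$ such that $r^s/C\le\mu(B(x,r))\le Cr^s$ for all $x\in E$ and all $0<r\le 1$. For $\delta>0$, $N_\delta(A)$ is the smallest number of balls of diameter $\delta$ that cover $A$, and the upper box dimension is $\overline{\dim}_B A=\limsup_{\delta\to 0}\frac{\log N_\delta(A)}{-\log\delta}$ (equal to $+\infty$ if $A$ is unbounded). *)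

(* Defs.v *)
From HB Require Import structures.
From mathcomp Require Import all_boot all_order all_algebra.
From mathcomp Require Import all_classical all_reals all_analysis.

Set Implicit Arguments.
Unset Strict Implicit.
Unset Printing Implicit Defensive.

Import Order.TTheory GRing.Theory Num.Theory.
Import numFieldNormedType.Exports.

Local Open Scope classical_set_scope.
Local Open Scope ring_scope.

(* R^2 is R * R, with the product topology and the product of the Borel
   sigma-algebras (which is the Borel sigma-algebra of the plane). *)
Definition planar_measure (R : realType) : Type :=
  {measure set (measurableTypeR R * measurableTypeR R) -> \bar R}.

(* The norm of the library on R * R is the max norm, so the Euclidean ball has
   to be written out. *)
Definition cball (R : realType) (x : R * R) (rho : R) : set (R * R) :=
  [set y | Num.sqrt ((y.1 - x.1) ^+ 2 + (y.2 - x.2) ^+ 2) <= rho].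

Definition is_Radon (R : realType) (mu : planar_measure R) : Prop :=
  [/\ forall K : set (R * R), compact K -> (mu K < +oo)%E,
      forall A : set (measurableTypeR R * measurableTypeR R), measurable A ->
        mu A = ereal_inf
          [set mu U | U in [set U : set (R * R) | open U /\ A `<=` U]]
    & forall U : set (R * R), open U ->
        mu U = ereal_sup
          [set mu K | K in [set K : set (R * R) | compact K /\ K `<=` U]]].

Definition spt (R : realType) (mu : planar_measure R) : set (R * R) :=
  [set x | forall rho : R, 0 < rho -> (0 < mu (cball x rho))%E].

Definition Ahlfors_regular (R : realType) (s : R) (E : set (R * R)) : Prop :=
  closed E /\
  exists (mu : planar_measure R) (C : R),
    [/\ is_Radon mu, spt mu = E, 0 < C
      & forall (x : R * R) (rho : R), E x -> 0 < rho <= 1 ->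
          ((rho `^ s / C)%:E <= mu (cball x rho) <= (C * rho `^ s)%:E)%E].

Definition pi_proj (R : realType) (r : R) (p : R * R) : R := p.1 + r * p.2.

(* Balls of diameter delta in R are taken closed, with arbitrary centres. The
   infimum of the empty set is +oo, which is the value when A is unbounded. *)
Definition covering_number (R : realType) (delta : R) (A : set R) : \bar R :=
  ereal_inf [set (n%:R)%:E | n in
    [set n : nat | exists c : 'I_n -> R,
       A `<=` \bigcup_(i in [set: 'I_n]) closed_ball (c i) (delta / 2)]].

Definition upper_box_dim (R : realType) (A : set R) : \bar R :=
  limf_esup
    (fun delta : R => lne (covering_number delta A) * ((- ln delta)^-1)%:E)%E
    (0 : R)^'+.

(* Main.v *)
(* Fix [rho = 2 ^ (-1/s) <= 1/2] and vectors [v_n] of max norm 1. Let [f] map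
   [t] in [[0, 1[] with binary digits [eps_n] to [\sum_n eps_n rho^n v_n], let [mu]
   be the image of the Lebesgue measure under [f] and let [E] be its support. Since
   [rho <= 1/2], the [2^n] partial sums of length [n] are [rho^n]-separated whatever
   the directions of the [v_n] are, so a ball of radius [rho^n] meets boundedly many
   cylinders of generation [n], each of mass [2^-n = (rho^n)^s]: [mu] is
   [s]-regular. Choose [v_n] in the kernel of [pi_{r_k}], with [k] depending on [n]
   and such that each [k] occurs once in every block of [P = 2^(k+1)] consecutive
   integers. These steps do not contribute to [pi_{r_k}(E)], which is covered by
   about [2^(n(1 - 1/P))] intervals of length [rho^n], hence has box dimension at
   most [s (1 - 1/P)]. *)
Require Import Defs.
From mathcomp Require Import all_boot all_order all_algebra.
From mathcomp Require Import all_classical all_reals all_analysis.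
From mathcomp Require Import measurable_realfun zify ring lra.

Set Implicit Arguments.
Unset Strict Implicit.
Unset Printing Implicit Defensive.

Import Order.TTheory GRing.Theory Num.Theory.
Import numFieldNormedType.Exports.

Local Open Scope classical_set_scope.
Local Open Scope ring_scope.

(** * Borel sets of the plane, Radon regularity and image measures *)

(** Measurability refers to the product sigma-algebra, so an open set is written as a countable
    union of open squares with rational centre and half-side, each a product of intervals. *)
Lemma open_plane_measurable (R : realType) (U : set (R * R)) : open U ->
  measurable (U : set (measurableTypeR R * measurableTypeR R)).
Proof.
move=> oU.
pose box (i : rat * rat * rat) : set (R * R) :=
  [set p | `|p.1 - ratr i.1.1| < ratr i.2 /\ `|p.2 - ratr i.1.2| < ratr i.2].
have -> : U = \bigcup_(i in [set: rat * rat * rat])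
                 if `[< box i `<=` U >] then box i else set0.
  apply/seteqP; split=> [x Ux|x [i _]]; last by case: asboolP => // iU /iU.
  have /nbhs_ballP[e /= e0 xeU] : nbhs x U by apply: open_nbhs_nbhs.
  have [q /[!in_itv]/= /andP[q0 qe]] : exists q : rat, ratr q \in `]0, (e / 2)[.
    by apply: rat_in_itvoo; rewrite divr_gt0.
  have near_rat (y : R) : exists a : rat, `|y - ratr a| < ratr q.
    have [|a] := @rat_in_itvoo R (y - ratr q) (y + ratr q); first by lra.
    by rewrite in_itv/= => ya; exists a; rewrite ltr_distlC.
  have [a ya] := near_rat x.1; have [b yb] := near_rat x.2.
  exists (a, b, q) => //; case: asboolP => [_|]; first by split.
  case=> y [/= y1 y2]; apply: xeU; rewrite prod_norm_ball /ball_/= prod_normE.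
  by rewrite gt_max; apply/andP; split; [
    apply: le_lt_trans (ler_distD (ratr a) _ _) _; rewrite [X in _ + X]distrC; lra|
    apply: le_lt_trans (ler_distD (ratr b) _ _) _; rewrite [X in _ + X]distrC; lra].
apply: countable_bigcupT_measurable => // -[[a b] q]; case: asboolP => // _.
have -> : box (a, b, q) = `]ratr a - ratr q, ratr a + ratr q[%classic
                      `*` `]ratr b - ratr q, ratr b + ratr q[%classic.
  by apply/seteqP; split => -[y z]; rewrite /box/= !in_itv/= !ltr_distl.
by apply: measurableX; exact: measurable_itv.
Qed.

Lemma closed_plane_measurable (R : realType) (A : set (R * R)) : closed A ->
  measurable (A : set (measurableTypeR R * measurableTypeR R)).
Proof.
by move=> /closed_openC/open_plane_measurable/measurableC; rewrite setCK.
Qed.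

Lemma compact_plane_measurable (R : realType) (K : set (R * R)) : compact K ->
  closed K /\ measurable (K : set (measurableTypeR R * measurableTypeR R)).
Proof.
move=> cK; have clK : closed K by apply: compact_closed cK; exact: norm_hausdorff.
by split=> //; exact: closed_plane_measurable.
Qed.

(** Inner approximation also gives outer regularity: if a compact [K] nearly exhausts the complement
    of [A], then the complement of [K] is an open superset of [A] of nearly the same measure. *)
Lemma tight_is_Radon (R : realType) (mu : planar_measure R) :
  (mu setT < +oo)%E ->
  (forall B : set (measurableTypeR R * measurableTypeR R), measurable B ->
    forall e : R, 0 < e -> exists K : set (R * R),
      [/\ compact K, K `<=` B & (mu (B `\` K) <= e%:E)%E]) ->
  is_Radon mu.
Proof.
move=> muT tight; split=> [K /compact_plane_measurable[_ mK]|A mA|U oU].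
- by apply: le_lt_trans muT; apply: le_measure => //; rewrite inE.
- apply/eqP; rewrite eq_le; apply/andP; split.
    apply: le_ereal_inf_tmp => _ [U [oU AU] <-].
    by apply: le_measure => //; rewrite inE//; exact: open_plane_measurable.
  apply/lee_addgt0Pr => e e0.
  have [K [/compact_plane_measurable[cK mK] KA muK]] :=
    tight _ (measurableC mA) _ e0.
  apply: (@le_trans _ _ (mu (~` K))).
    apply: ge_ereal_inf; exists (mu (~` K)) => //; exists (~` K) => //.
    split; first exact: closed_openC.
    by move=> x Ax Kx; exact: KA Kx Ax.
  have -> : ~` K = A `|` (~` A `\` K).
    apply/seteqP; split=> x; last by case=> [Ax Kx|[]//]; exact: KA Kx Ax.
    by have [Ax|nAx] := pselect (A x) => nKx; [left|right].
  rewrite measureU//; first by rewrite leeD2l.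
    by apply: measurableD => //; exact: measurableC.
  by apply/seteqP; split=> x // [] ? [].
- have mU := open_plane_measurable oU.
  apply/eqP; rewrite eq_le; apply/andP; split; last first.
    apply: ge_ereal_sup => _ [K [/compact_plane_measurable[_ mK] KU] <-].
    by apply: le_measure => //; rewrite inE.
  apply/lee_addgt0Pr => e e0.
  have [K [cK KU muK]] := tight _ mU _ e0.
  have [_ mK] := compact_plane_measurable cK.
  have {1}-> : U = K `|` (U `\` K) by rewrite setDUK.
  rewrite measureU//; last 2 first.
    exact: measurableD.
    by apply/seteqP; split=> x // [] ? [].
  by apply: leeD => //; apply: ereal_sup_ubound; exists K.
Qed.

Lemma pushforward_measure_exists d1 d2 (T1 : measurableType d1)
    (T2 : measurableType d2) (R : realType) (m : {measure set T1 -> \bar R})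
    (f : T1 -> T2) : measurable_fun [set: T1] f ->
  exists mu : {measure set T2 -> \bar R}, forall A, mu A = m (f @^-1` A).
Proof.
move=> mf.
by exists (measure_function_pushforward__canonical__measure_function_Measure m mf).
Qed.

(** * Binary sums, their separation and their limit *)

Section binary_sums.
Variables (R : realType) (rho : R) (v : nat -> R * R).
Hypotheses (rho_gt0 : 0 < rho) (rho_le : rho <= 2^-1) (v1 : forall n, `|v n| = 1).

(* Binary digits of [m < 2 ^ n] are read from the most significant one, so that
   halving [m] forgets the last step of the construction. *)
Fixpoint bsum (n m : nat) : R * R :=
  if n is n'.+1 then bsum n' m./2 + (rho ^+ n' *+ odd m) *: v n' else 0.

(** [Num.truncn] is [0] on negative reals, so the index makes sense for every real [t]. *)
Definition dyadic_index (n : nat) (t : R) : nat := Num.truncn (2 ^+ n * t).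

Lemma dyadic_indexS n t : (dyadic_index n.+1 t)./2 = dyadic_index n t.
Proof.
rewrite /dyadic_index exprS -mulrA; set x := _ * t.
have [x0|x0] := leP 0 x; last first.
  by rewrite !truncn_floor !leNgt pmulr_rlt0// x0.
apply/esym/eqP; rewrite truncn_eq//; set m := Num.truncn (2 * x).
have /andP[] : m%:R <= 2 * x < m.+1%:R by rewrite truncn_itv// mulr_ge0.
rewrite -[in m%:R](odd_double_half m) -[in m.+1%:R](odd_double_half m).
have : (m./2.*2)%:R = 2 * (m./2%:R) :> R by rewrite -mul2n natrM.
rewrite -!natr1 !natrD => ->.
by case: (odd m) => /=; rewrite ?addr0 => *; apply/andP; split; lra.
Qed.

Lemma bsum_step n t :
  `|bsum n.+1 (dyadic_index n.+1 t) - bsum n (dyadic_index n t)| <= rho ^+ n.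
Proof.
rewrite /= dyadic_indexS addrAC subrr add0r normrZ v1 mulr1.
have rn := ltW (exprn_gt0 n rho_gt0).
by case: (odd _); rewrite ?mulr0n ?mulr1n ?normr0// ger0_norm.
Qed.

(** The gap is [rho ^+ (n - 1)]; the factor [rho] avoids that exponent. In the induction step, sums
    differing in the last digit only are exactly [rho ^+ n] apart. Otherwise the previous gap is at
    least [2 * rho ^+ n], as [rho <= 2^-1], and the new terms change the difference by at most
    [rho ^+ n]. *)
Lemma bsum_separated n m m' : (m < 2 ^ n)%N -> (m' < 2 ^ n)%N -> m != m' ->
  rho ^+ n <= rho * `|bsum n m - bsum n m'|.
Proof.
elim: n m m' => [|n IH] m m'; first by case: m m' => [|m] [|m'].
rewrite !expnS => mn m'n mm'; have rn := exprn_gt0 n rho_gt0.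
have [h|h] := eqVneq m./2 m'./2.
  have oo : odd m != odd m'.
    by apply: contra_neq mm' => oo; rewrite -(odd_double_half m) h oo odd_double_half.
  rewrite /= h opprD addrACA subrr add0r -scalerBl normrZ v1 mulr1 exprS ler_pM2l//.
  by case: (odd m) (odd m') oo => [] [] //= _;
    rewrite ?mulr0n ?mulr1n ?subr0 ?sub0r ?normrN ger0_norm// ltW.
have half_lt k : (k < 2 * 2 ^ n)%N -> (k./2 < 2 ^ n)%N.
  by move=> kn; rewrite ltn_half_double -mul2n.
have := IH _ _ (half_lt _ mn) (half_lt _ m'n) h.
set a := bsum n _; set b := bsum n _ => ab.
have dig : `|(rho ^+ n *+ odd m) *: v n - (rho ^+ n *+ odd m') *: v n| <= rho ^+ n.
  rewrite -scalerBl normrZ v1 mulr1.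
  by case: (odd m) (odd m') => [] [];
    rewrite ?mulr0n ?mulr1n ?subrr ?subr0 ?sub0r ?normrN ?normr0 ?ger0_norm// ltW.
rewrite /= -/a -/b opprD addrACA.
have : `|a - b| - rho ^+ n <= `|a - b + ((rho ^+ n *+ odd m) *: v n
          - (rho ^+ n *+ odd m') *: v n)|.
  by apply: le_trans (lerB_normD _ _); rewrite lerB.
move=> tri; rewrite exprS ler_pM2l//; apply: le_trans tri.
have rN : 2 * rho ^+ n <= `|a - b|.
  rewrite -(ler_pM2l rho_gt0); apply: le_trans ab.
  by have := ler_wpM2r (ltW rn) rho_le; lra.
lra.
Qed.

(** In each coordinate, the intervals of radius [2 * rho ^+ n] around the partial sums are nested
    because [rho <= 2^-1]; the limit is the supremum of their left ends. *)
Lemma bsum_limit_exists :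
  exists f : R -> R * R, forall n t,
    `|f t - bsum n (dyadic_index n t)| <= 2 * rho ^+ n.
Proof.
have nested (u : nat -> R) : (forall n, `|u n.+1 - u n| <= rho ^+ n) ->
    exists x, forall n, `|x - u n| <= 2 * rho ^+ n.
  move=> hu; pose e n := 2 * rho ^+ n.
  have e_ge n : rho ^+ n <= e n - e n.+1.
    have := ler_wpM2r (ltW (exprn_gt0 n rho_gt0)) rho_le; rewrite /e exprS; lra.
  have up : {homo (fun n => u n - e n) : n m / (n <= m)%N >-> n <= m}.
    apply: homo_leq => [//|? ? ?|n] /=; first exact: le_trans.
    have := hu n; have := e_ge n; rewrite ler_norml => ? /andP[]. lra.
  have dn : {homo (fun n => - (u n + e n)) : n m / (n <= m)%N >-> n <= m}.
    apply: homo_leq => [//|? ? ?|n] /=; first exact: le_trans.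
    by have := hu n; have := e_ge n; rewrite ler_norml => ? /andP[]; lra.
  have ub n m : u m - e m <= u n + e n.
    have /= := up _ _ (leq_maxl m n); have /= := dn _ _ (leq_maxr m n).
    have /= : 0 < e (maxn m n) by rewrite mulr_gt0// exprn_gt0.
    by move=> *; lra.
  exists (sup (range (fun m => u m - e m))) => n; rewrite ler_distl.
  have bd : ubound (range (fun m => u m - e m)) (u n + e n) by move=> _ [m _ <-].
  apply/andP; split; last by apply: ge_sup => //; exists (u 0 - e 0); exists 0.
  by apply: ub_le_sup; [exists (u n + e n)|exists n].
have coord t : exists p : R * R, forall n,
    `|p - bsum n (dyadic_index n t)| <= 2 * rho ^+ n.
  have [|x hx] := nested (fun n => (bsum n (dyadic_index n t)).1).
    by move=> n; apply: le_trans (bsum_step n t); rewrite [leRHS]prod_normE le_max lexx.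
  have [|y hy] := nested (fun n => (bsum n (dyadic_index n t)).2).
    by move=> n; apply: le_trans (bsum_step n t); rewrite [leRHS]prod_normE le_max lexx orbT.
  by exists (x, y) => n; rewrite prod_normE ge_max hx hy.
by have [f hf] := choice coord; exists f.
Qed.

End binary_sums.

(** * Continuity, measurability and tightness of the coding map *)

Section coding_map.
Variables (R : realType) (rho : R) (v : nat -> R * R) (f : R -> R * R).
Hypotheses (rho_gt0 : 0 < rho) (rho_lt1 : rho < 1).
Hypothesis f_bsum : forall n t,
  `|f t - bsum rho v n (dyadic_index n t)| <= 2 * rho ^+ n.

Lemma dist_same_index n t u :
  dyadic_index n t = dyadic_index n u -> `|f t - f u| <= 4 * rho ^+ n.
Proof.
move=> tu; have := f_bsum n t; have := f_bsum n u; rewrite tu [X in X <= _ -> _]distrC.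
have := ler_distD (bsum rho v n (dyadic_index n u)) (f t) (f u); lra.
Qed.

(** A countable, hence Lebesgue-null, set containing every jump of every [dyadic_index n]. *)
Definition dyadics : set R :=
  [set (p.2%:R / 2 ^+ p.1 : R) | p in [set: nat * nat]].

Lemma countable_dyadics : countable dyadics.
Proof. by apply: sub_countable (card_image_le _ _) _; exact: countableP. Qed.

Lemma measurable_dyadics : measurable dyadics.
Proof. by apply: countable_measurable countable_dyadics. Qed.

Lemma dyadic_index_near n t : ~ dyadics t ->
  \forall u \near t, dyadic_index n u = dyadic_index n t.
Proof.
move=> nt; have p2 : 0 < 2 ^+ n :> R by rewrite exprn_gt0.
have lt_next : t < (dyadic_index n t).+1%:R / 2 ^+ n.
  by rewrite ltr_pdivlMr// mulrC truncnS_gt.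
(* Index [0] covers all negative [t] too, so only the upper end of the cell constrains [u]. *)
have [d0|d0] := posnP (dyadic_index n t).
  near=> u; apply/eqP; rewrite d0 -leqn0 truncn_le_nat mulrC -ltr_pdivlMr//.
  by near: u; apply: lt_nbhsl; move: lt_next; rewrite d0.
have t0 : 0 <= 2 ^+ n * t by apply/ltW/(lt_le_trans ltr01); rewrite -truncn_gt0.
have gt_this : (dyadic_index n t)%:R / 2 ^+ n < t.
  rewrite lt_neqAle ler_pdivrMr// [t * _]mulrC truncn_le t0 andbT.
  by apply/eqP => e; apply: nt; exists (n, dyadic_index n t).
near=> u; apply/eqP.
have gt_u : (dyadic_index n t)%:R / 2 ^+ n < u by near: u; exact: lt_nbhsr.
have lt_u : u < (dyadic_index n t).+1%:R / 2 ^+ n by near: u; exact: lt_nbhsl.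
move: gt_u lt_u; rewrite ltr_pdivrMr// ltr_pdivlMr// => gt_u lt_u.
rewrite [dyadic_index n u]/dyadic_index truncn_eq mulrC.
  by rewrite (ltW gt_u) lt_u.
by apply: le_trans (ltW gt_u); rewrite ler0n.
Unshelve. all: by end_near. Qed.

Lemma rhoX_small e : 0 < e -> exists n, rho ^+ n < e.
Proof.
move=> e0; have : rho ^+ n @[n --> \oo] --> (0 : R).
  by apply: cvg_expr; rewrite gtr0_norm.
move=> /cvgr0Pnorm_lt/(_ _ e0)[N _ /(_ N (leqnn N))] /=.
by rewrite gtr0_norm ?exprn_gt0//; exists N.
Qed.

Lemma coding_continuous t : ~ dyadics t -> {for t, continuous f}.
Proof.
move=> nt; apply/cvgrPdist_lt => e e0.
have [n rn] := rhoX_small (divr_gt0 e0 (ltr0n R 4)).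
near=> u; have : dyadic_index n u = dyadic_index n t.
  by near: u; exact: dyadic_index_near.
by move/esym/dist_same_index => /le_lt_trans; apply; lra.
Unshelve. all: by end_near. Qed.

(** Each coordinate is continuous off the countable set [dyadics], and within that set every
    preimage is countable. *)
Lemma measurable_coding : measurable_fun [set: measurableTypeR R]
  (f : measurableTypeR R -> measurableTypeR R * measurableTypeR R).
Proof.
have comp (p : R * R -> R) : continuous p ->
    measurable_fun [set: measurableTypeR R] (p \o f : measurableTypeR R -> measurableTypeR R).
  move=> cp; rewrite -(setvU dyadics); apply/measurable_funU.
  - exact: measurableC measurable_dyadics.
  - exact: measurable_dyadics.
  split.
    apply: subspace_continuous_measurable_fun; first exact: measurableC measurable_dyadics.
    apply: continuous_in_subspaceT => t /[!inE] nt.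
    by apply: continuous_comp; [exact: coding_continuous|exact: cp].
  move=> _ Y mY; apply: countable_measurable => //.
  by apply: sub_countable countable_dyadics; apply: subset_card_le; exact: subIsetl.
by apply/measurable_fun_pairP; split; apply: comp => x; [exact: cvg_fst|exact: cvg_snd].
Qed.

Let leb := @lebesgue_measure R.

(* Off the dyadic points [f] is continuous, so that it maps the compact sets
   provided by the regularity of the Lebesgue measure to compact sets. *)
Lemma coding_tight (B : set (measurableTypeR R * measurableTypeR R)) (e : R) :
  measurable B -> 0 < e ->
  exists K : set (R * R), [/\ compact K, K `<=` B
    & (leb (f @^-1` (B `\` K) `&` `[0%R, 1%R[%classic) <= e%:E)%E].
Proof.
move=> mB e0; pose D := (f @^-1` B `&` `[0%R, 1%R[%classic) `\` dyadics.
have mfB : measurable (f @^-1` B).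
  by rewrite -[f @^-1` B]setTI; exact: measurable_coding.
have mD : measurable (D : set (measurableTypeR R)).
  by apply: measurableD measurable_dyadics; apply: measurableI.
have D1 : (leb D < +oo)%E.
  apply: (@le_lt_trans _ _ (leb `[0%R, 1%R[%classic)).
    by apply: le_measure; rewrite ?inE// => t [[]].
  by rewrite /leb lebesgue_measure_itv/= lte01 sube0 ltry.
have [V [cV VD DV]] := lebesgue_regularity_inner mD D1 e0.
exists (f @` V); split.
- apply: continuous_compact cV; apply: continuous_in_subspaceT => t; rewrite inE => /VD[_].
  exact: coding_continuous.
- by move=> _ [t Vt <-]; have [[]] := VD _ Vt.
have mV := compact_measurable cV.
have mDV : measurable (D `\` V) by exact: measurableD.
(* A parameter in [V] is sent into [K], so what escapes [K] lies in [D] minus [V] or is dyadic. *)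
apply: (@le_trans _ _ (leb ((D `\` V) `|` dyadics))).
  apply: le_outer_measure => t [[Bt nVt] t01]; have [dt|dt] := pselect (dyadics t).
    by right.
  by left; split=> // Vt; apply: nVt; exists t.
apply: le_trans (outer_measureU2 _ _ _) _.
rewrite /leb [X in (_ + X)%E]countable_lebesgue_measure0 ?adde0 ?ltW//.
exact: countable_dyadics.
Qed.

End coding_map.

(** * Ahlfors regularity of the image measure *)

Lemma cball_subnorm (R : realType) (x y : R * R) (d : R) :
  cball x d y -> `|y - x| <= d.
Proof.
rewrite /cball/= => yx; rewrite prod_normE ge_max; apply/andP; split.
  by apply: le_trans yx; rewrite -sqrtr_sqr ler_wsqrtr// lerDl sqr_ge0.
by apply: le_trans yx; rewrite -sqrtr_sqr ler_wsqrtr// lerDr sqr_ge0.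
Qed.

(** The factor 2 is a convenient bound for the sharp constant, the square root of 2. *)
Lemma norm_subcball (R : realType) (x y : R * R) (d : R) :
  `|y - x| <= d / 2 -> cball x d y.
Proof.
move=> yx; have d0 : 0 <= d by have := le_trans (normr_ge0 _) yx; lra.
rewrite /cball/= -(ger0_norm d0) -sqrtr_sqr ler_wsqrtr//.
move: yx; rewrite prod_normE ge_max => /andP[]; rewrite !ler_norml => /andP[a1 a2] /andP[b1 b2].
by rewrite /= in a1 a2 b1 b2; nra.
Qed.

(** The least exponent with power below [d] is positive because [d <= 1]; [n] is its predecessor. *)
Lemma geometric_scale (R : realType) (q d : R) : 0 < q < 1 -> 0 < d <= 1 ->
  exists n, q ^+ n.+1 < d <= q ^+ n.
Proof.
move=> /andP[q0 q1] /andP[d0 d1]; have ex := rhoX_small q0 q1 d0.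
case: (ex_minnP ex) => -[|n] qn min; first by move: qn; rewrite expr0 ltNge d1.
by exists n; rewrite qn leNgt; apply/negP => /min; rewrite ltnn.
Qed.

Section natural_measure.
Variables (R : realType) (s rho : R) (v : nat -> R * R) (f : R -> R * R).
Variable mu : planar_measure R.
Hypotheses (s_gt0 : 0 < s) (rho_gt0 : 0 < rho) (rho_le : rho <= 2^-1).
Hypotheses (v1 : forall n, `|v n| = 1) (rhoXs : rho `^ s = 2^-1).
Hypothesis f_bsum : forall n t,
  `|f t - bsum rho v n (dyadic_index n t)| <= 2 * rho ^+ n.
Let leb := @lebesgue_measure R.
Hypothesis muE : forall A : set (R * R),
  mu A = leb (f @^-1` A `&` `[0%R, 1%R[%classic).

Let rho_lt1 : rho < 1. Proof. by have := rho_le; lra. Qed.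

Lemma rhoXnXs n : (rho ^+ n) `^ s = 2^-1 ^+ n.
Proof.
by rewrite -powR_mulrn ?ltW// -powRrM mulrC powRrM rhoXs powR_mulrn// invr_ge0.
Qed.

(** The parameters of one cylinder of generation [n]; half-open, so that cylinders of one generation
    are disjoint. *)
Definition dyadic_itv n m : set R := `[m%:R / 2 ^+ n, m.+1%:R / 2 ^+ n[%classic.

Lemma dyadic_itvE n m t : 0 <= t ->
  dyadic_itv n m t <-> dyadic_index n t = m.
Proof.
move=> t0; have p2 : 0 < 2 ^+ n :> R by rewrite exprn_gt0.
rewrite /dyadic_itv/= in_itv/= ler_pdivrMr// ltr_pdivlMr// [t * _]mulrC.
by rewrite -truncn_eq ?mulr_ge0// ?ltW//; split=> /eqP.
Qed.

Lemma dyadic_itv_measure n m : leb (dyadic_itv n m) = (2^-1 ^+ n)%:E.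
Proof.
have p2 : 0 < 2 ^+ n :> R by rewrite exprn_gt0.
rewrite /leb lebesgue_measure_itv/= lte_fin ltr_pM2r ?invr_gt0// ltr_nat leqnn.
by rewrite -EFinB -mulrBl -natr1 addrAC subrr add0r mul1r exprVn.
Qed.

Lemma dyadic_index_lt n (t : R) : 0 <= t < 1 -> (dyadic_index n t < 2 ^ n)%N.
Proof.
move=> /andP[t0 t1]; rewrite truncn_lt_nat ?mulr_ge0 ?exprn_ge0//.
by rewrite natrX -[ltRHS]mulr1 ltr_pM2l// exprn_gt0.
Qed.

Lemma mu_le (A B : set (R * R)) : A `<=` B -> (mu A <= mu B)%E.
Proof. by move=> AB; rewrite !muE; apply: le_outer_measure => t [/AB]. Qed.

(** Cut the square of half-side [3 * rho ^+ n] into cells of side [rho ^+ n]. A scaled coordinate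
    lies in the closed interval from 0 to 6, so its integer part takes 7 values, whence [7 * 7]
    cells. Two sums in one cell are less than [rho ^+ n] apart, so separation makes them equal. *)
Lemma card_bsum_near n (x : R * R) :
  (#|[set m : 'I_(2 ^ n) | (`|bsum rho v n m - x| <= 3 * rho ^+ n)%R]%SET| <= 49)%N.
Proof.
set S := [set _ | _]%SET; have rn := exprn_gt0 n rho_gt0.
pose c (y : R) : nat := Num.truncn (y / rho ^+ n + 3).
have c_lt y : `|y| <= 3 * rho ^+ n -> 0 <= y / rho ^+ n + 3 /\ (c y < 7)%N.
  rewrite -ler_pdivrMr// -[X in _ / X](gtr0_norm rn) -normf_div ler_norml => /andP[y1 y2].
  have y0 : 0 <= y / rho ^+ n + 3 by lra.
  by split => //; rewrite truncn_lt_nat//; lra.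
have c_inj y z : `|y| <= 3 * rho ^+ n -> `|z| <= 3 * rho ^+ n -> c y = c z ->
    `|y - z| < rho ^+ n.
  move=> /c_lt[y0 _] /c_lt[z0 _] yz.
  have /andP[y1 y2] := truncn_itv y0; have /andP[z1 z2] := truncn_itv z0.
  rewrite -/(c y) in y1 y2; rewrite -/(c z) -yz in z1 z2.
  rewrite -natr1 in y2 z2.
  have : `|y / rho ^+ n - z / rho ^+ n| < 1 by rewrite ltr_norml; lra.
  by rewrite -mulrBl normrM normfV (gtr0_norm rn) ltr_pdivrMr// mul1r.
pose g (m : 'I_(2 ^ n)) : 'I_7 * 'I_7 :=
  (inord (c ((bsum rho v n m).1 - x.1)), inord (c ((bsum rho v n m).2 - x.2))).
have -> : 49%N = #|{: 'I_7 * 'I_7}| by rewrite card_prod card_ord.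
apply: (@leq_card_in _ _ g) => m m'; rewrite !inE !prod_normE !ge_max.
move=> /andP[/= m1 m2] /andP[m'1 m'2] [/(congr1 val) + /(congr1 val)].
have [_ cm1] := c_lt _ m1; have [_ cm2] := c_lt _ m2.
have [_ cm'1] := c_lt _ m'1; have [_ cm'2] := c_lt _ m'2.
rewrite /= !inordK// => /(c_inj _ _ m1 m'1) + /(c_inj _ _ m2 m'2).
rewrite !opprB !addrA !subrK => d1 d2; apply/val_inj/eqP/negPn/negP => /=.
move=> /(bsum_separated rho_gt0 rho_le v1 (ltn_ord m) (ltn_ord m')).
apply/negP; rewrite -ltNge.
apply: (@le_lt_trans _ _ `|bsum rho v n m - bsum rho v n m'|).
  by rewrite ler_piMl// ltW.
by rewrite prod_normE gt_max d1 d2.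
Qed.

(** If [f t] is in the ball, the partial sum of its cylinder is within [(1 + 2) * rho ^+ n] of [x].
    At most 49 cylinders qualify, each of mass [2^-1 ^+ n]. *)
Lemma mu_norm_ball n (x : R * R) :
  (mu [set y | (`|y - x| <= rho ^+ n)%R] <= (49 * 2^-1 ^+ n)%:E)%E.
Proof.
pose S := [set m : 'I_(2 ^ n) | (`|bsum rho v n m - x| <= 3 * rho ^+ n)%R]%SET.
have big_le : (leb (\big[setU/set0]_(m in S) dyadic_itv n m) <=
               \sum_(m in S) leb (dyadic_itv n m))%E.
  apply: (big_ind2 (fun A (b : \bar R) => (leb A <= b)%E)) => //.
    by rewrite /leb measure0.
  by move=> A a B b Aa Bb; apply: le_trans (outer_measureU2 _ _ _) _; exact: leeD.
rewrite muE; apply: (le_trans (le_trans (le_outer_measure _ _ _ _) big_le)); last first.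
  under eq_bigr do rewrite dyadic_itv_measure.
  rewrite sumEFin lee_fin sumr_const -[leLHS]mulr_natl ler_pM2r ?exprn_gt0//.
  by rewrite ler_nat card_bsum_near.
move=> t [/= ftx]; rewrite in_itv/= => t01.
pose m := Ordinal (dyadic_index_lt n t01); have mS : m \in S.
  rewrite inE; have := f_bsum n t; have := ler_distD (f t) (bsum rho v n m) x.
  by rewrite [X in _ <= X + _]distrC /=; lra.
by rewrite (bigD1 m)//=; left; apply/dyadic_itvE => //; have /andP[] := t01.
Qed.

Lemma mu_cball_le (x : R * R) (d : R) : 0 < d <= 1 ->
  (mu (cball x d) <= (98 * d `^ s)%:E)%E.
Proof.
move=> d01; have [|n /andP[dn nd]] := @geometric_scale _ rho d _ d01.
  by rewrite rho_gt0.
apply: le_trans (mu_le _) (le_trans (mu_norm_ball n x) _).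
  by move=> y /cball_subnorm /le_trans; apply.
(* Passing from [rho ^+ n] to [rho ^+ n.+1] costs a factor 2 in mass, hence [98 = 2 * 49]. *)
have : (rho ^+ n.+1) `^ s <= d `^ s.
  by apply: ge0_ler_powR; rewrite ?nnegrE ?exprn_ge0 ?ltW//; case/andP: d01.
by rewrite lee_fin rhoXnXs exprS; lra.
Qed.

(** The ball contains the image of a whole cylinder through [t]. The centre may be off the image, so
    that every point of the support can be treated. *)
Lemma mu_cball_ge (p : R * R) (t d : R) : 0 <= t < 1 -> 0 < d <= 1 ->
  `|p - f t| <= d / 4 -> ((d `^ s / 32)%:E <= mu (cball p d))%E.
Proof.
move=> t01 d01 pt; have [|n /andP[dn nd]] := @geometric_scale _ rho d _ d01.
  by rewrite rho_gt0.
(* Five generations further, a cylinder has diameter at most [4 * rho ^+ N <= d / 4]; with the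
   offset [d / 4] this gives the [d / 2] of [norm_subcball]. Its mass is [2^-1 ^+ n / 32]. *)
pose N := (5 + n)%N; pose m := dyadic_index N t.
have rN : rho ^+ N <= d / 16.
  have : rho ^+ 4 <= 2^-1 ^+ 4.
    by rewrite lerXn2r// ?nnegrE ?invr_ge0// ltW.
  have := exprn_gt0 4 rho_gt0; have := exprn_gt0 n.+1 rho_gt0.
  have -> : N = (4 + n.+1)%N by rewrite addnS.
  rewrite exprD.
  move=> a0 b0 b1; have := ler_pM (ltW b0) (ltW a0) b1 (ltW dn).
  by rewrite [2^-1 ^+ 4]exprS !exprS expr0; lra.
apply: (@le_trans _ _ (leb (dyadic_itv N m))).
  rewrite dyadic_itv_measure lee_fin.
  have : d `^ s <= (rho ^+ n) `^ s.
    have /andP[d0 _] := d01.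
    by apply: ge0_ler_powR nd; rewrite ?nnegrE ?exprn_ge0 ?ltW.
  by rewrite rhoXnXs /N !exprS; lra.
rewrite muE; apply: le_outer_measure => u mu_.
have [t0 t1] := andP t01.
have u01 : 0 <= u < 1.
  move: mu_; rewrite /dyadic_itv/= in_itv/= => /andP[u1 u2]; apply/andP; split.
    by apply: le_trans u1; rewrite divr_ge0// exprn_ge0.
  apply: lt_le_trans u2 _; rewrite ler_pdivrMr ?exprn_gt0// mul1r -natrX ler_nat.
  exact: dyadic_index_lt.
split; last by rewrite /= in_itv.
apply: norm_subcball; have /dyadic_itvE um := mu_; have [u0 _] := andP u01.
have := dist_same_index f_bsum (um u0); have := ler_distD (f t) (f u) p.
by rewrite [X in _ <= _ + X]distrC; lra.
Qed.

(** A ball missing the image of the unit interval is null; thus the support lies in the closure of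
    that image. *)
Lemma spt_near_coding (x : R * R) (e : R) : spt mu x -> 0 < e ->
  exists t, 0 <= t < 1 /\ `|x - f t| <= e.
Proof.
move=> xE e0; apply: contrapT => no.
have := xE _ e0; apply/negP; rewrite -leNgt muE.
suff -> : f @^-1` cball x e `&` `[0%R, 1%R[%classic = set0 by rewrite /leb measure0.
apply/seteqP; split=> // t [/cball_subnorm fxt /=]; rewrite in_itv/= => t01.
by apply: no; exists t; rewrite distrC.
Qed.

Lemma coding_in_spt t : 0 <= t < 1 -> spt mu (f t).
Proof.
(* The lower bound on masses is available for radii at most 1 only. *)
move=> t01 d d0; pose d' := Num.min d 1.
have d'01 : 0 < d' <= 1 by rewrite lt_min d0 ltr01 ge_min lexx orbT.
have [d'0 _] := andP d'01.
apply: (@lt_le_trans _ _ (d' `^ s / 32)%:E).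
  by rewrite lte_fin divr_gt0// powR_gt0.
apply: (@le_trans _ _ (mu (cball (f t) d'))).
  by apply: mu_cball_ge t01 d'01 _; rewrite subrr normr0 divr_ge0// ltW.
by apply: mu_le => y /le_trans; apply; rewrite ge_min lexx.
Qed.

Lemma closed_spt : closed (spt mu).
Proof.
move=> x cx d d0.
have [|y [yE /=]] := cx (ball x (d / 4)); first by apply: nbhsx_ballx; lra.
rewrite prod_norm_ball /ball_/= => xy.
have d4 : 0 < d / 4 by rewrite divr_gt0.
apply: lt_le_trans (yE _ d4) _; apply: mu_le => z /cball_subnorm zy.
apply: norm_subcball; have := ler_distD y z x.
by rewrite [X in _ <= _ + X]distrC; lra.
Qed.

Lemma Ahlfors_regular_spt : is_Radon mu -> Ahlfors_regular s (spt mu).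
Proof.
move=> radon; split; first exact: closed_spt.
exists mu, 98; split=> // x d xE d01; have [d0 _] := andP d01; apply/andP; split.
  have [|t [t01 xt]] := spt_near_coding xE (e := d / 4); first lra.
  apply: le_trans (mu_cball_ge t01 d01 xt); rewrite lee_fin.
  by have := powR_ge0 d s; lra.
exact: mu_cball_le.
Qed.

End natural_measure.

(** * Box dimension of a projection that kills one step per period *)

Section box_dimension.
Variables (R : realType) (s rho : R) (v : nat -> R * R) (E : set (R * R)) (a : R).
Hypotheses (rho01 : 0 < rho < 1) (s_gt0 : 0 < s) (rhoXs : rho `^ s = 2^-1).
Hypothesis E_near : forall x N, E x ->
  exists m, `|x - bsum rho v N m| <= 3 * rho ^+ N.
Variable k : nat.
Hypothesis v_ker : forall n, logn 2 n.+1 = k -> pi_proj a (v n) = 0.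

Let period := (2 ^ k.+1)%N.

(** Block [q] contains [j.+1 = period * q + 2 ^ k], which is [2 ^ k] times an odd number and so has
    valuation [k]; the other [period.-1] terms are bounded by 1. *)
Lemma count_missed q :
  (\sum_(j < period * q) (logn 2 j.+1 != k) <= period.-1 * q)%N.
Proof.
elim: q => [|q IH]; first by rewrite muln0 big_ord0.
rewrite mulnS addnC big_split_ord /= mulnS addnC leq_add//.
have i0P : ((2 ^ k).-1 < period)%N.
  by rewrite /period expnS prednK ?expn_gt0// leq_pmull.
rewrite (bigD1 (Ordinal i0P))//= -addnS prednK ?expn_gt0//.
rewrite (_ : period * q + 2 ^ k = 2 ^ k * q.*2.+1)%N; last first.
  by rewrite /period expnS -muln2; lia.
have odd0 : logn 2 q.*2.+1 = 0%N by rewrite lognE dvdn2 /= odd_double.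
rewrite lognM ?expn_gt0// pfactorK// odd0 addn0 eqxx /= add0n.
apply: (@leq_trans (\sum_(i < period | i != Ordinal i0P) 1)).
  by apply: leq_sum => i _; exact: leq_b1.
by rewrite sum1_card cardC1 card_ord.
Qed.

(** Candidate projections of the partial sums. Repetitions are harmless: the length, doubled only at
    steps not known to lie in the kernel, bounds the number of intervals needed. *)
Fixpoint proj_values (n : nat) : seq R :=
  if n is n'.+1 then
    if logn 2 n == k then proj_values n'
    else proj_values n' ++
         [seq x + rho ^+ n' * pi_proj a (v n') | x <- proj_values n']
  else [:: 0].

Lemma pi_projD (x y : R * R) : pi_proj a (x + y) = pi_proj a x + pi_proj a y.
Proof. by rewrite /pi_proj /=; ring. Qed.

Lemma pi_projZ (c : R) (x : R * R) : pi_proj a (c *: x) = c * pi_proj a x.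
Proof. by rewrite /pi_proj /= mulrDr mulrCA. Qed.

Lemma norm_pi_projB (x y : R * R) :
  `|pi_proj a x - pi_proj a y| <= (1 + `|a|) * `|x - y|.
Proof.
have -> : pi_proj a x - pi_proj a y = (x.1 - y.1) + a * (x.2 - y.2).
  by rewrite /pi_proj; ring.
apply: le_trans (ler_normD _ _) _; rewrite normrM mulrDl mul1r.
by apply: lerD; rewrite ?ler_wpM2l// [leRHS]prod_normE le_max lexx ?orbT.
Qed.

Lemma proj_bsum n m : pi_proj a (bsum rho v n m) \in proj_values n.
Proof.
elim: n m => [|n IH] m; first by rewrite /= inE /pi_proj /= mulr0 addr0.
rewrite /= pi_projD pi_projZ; case: eqP => [/v_ker->|_].
  by rewrite mulr0 addr0.
rewrite mem_cat; case: (odd m); rewrite ?mulr0n ?mul0r ?addr0 ?IH// mulr1n.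
by rewrite (map_f (fun x => x + _)) ?orbT.
Qed.

Lemma size_proj_values n :
  size (proj_values n) = (2 ^ \sum_(j < n) (logn 2 j.+1 != k))%N.
Proof.
elim: n => [|n IH]; first by rewrite big_ord0.
rewrite /= big_ord_recr /=; case: eqP => _; first by rewrite addn0.
by rewrite size_cat size_map IH addn1 expnS mul2n addnn.
Qed.

Lemma covering_number_ge0 (d : R) (A : set R) : (0 <= covering_number d A)%E.
Proof.
by apply: le_ereal_inf_tmp => _ [n _ <-]; rewrite lee_fin ler0n.
Qed.

(** Intervals centred at the candidate values suffice: [E] is within [3 * rho ^+ N] of the partial
    sums and [pi_proj a] is Lipschitz with constant [1 + |a|]. *)
Lemma covering_number_proj (q : nat) (d : R) : 0 < d ->
  3 * (1 + `|a|) * rho ^+ (period * q) <= d / 2 ->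
  (covering_number d (pi_proj a @` E) <= (2 ^+ (period.-1 * q))%:E)%E.
Proof.
move=> d0 hd; set N := (period * q)%N.
apply: (@le_trans _ _ (size (proj_values N))%:R%:E); last first.
  rewrite lee_fin size_proj_values -natrX ler_nat leq_exp2l//.
  exact: count_missed.
apply: ge_ereal_inf; exists (size (proj_values N))%:R%:E => //.
exists (size (proj_values N)) => //.
exists (fun i => nth 0 (proj_values N) i) => _ [x Ex <-].
have [m xm] := E_near N Ex; have mem := proj_bsum N m.
exists (Ordinal (etrans (index_mem _ _) mem)) => //=.
rewrite closed_ballE ?divr_gt0// /closed_ball_/= nth_index// distrC.
apply: le_trans (norm_pi_projB _ _) (le_trans _ hd).
by rewrite [3 * _]mulrC -mulrA ler_wpM2l// addr_ge0.
Qed.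

Lemma upper_box_dim_proj_lt : (upper_box_dim (pi_proj a @` E) < s%:E)%E.
Proof.
have [rho0 rho1] := andP rho01; set P : R := period%:R.
have P2 : 2 <= P by rewrite ler_nat /period expnS leq_pmulr ?expn_gt0.
have ln2 : 0 < ln (2 : R) by rewrite ln_gt0// ltr1n.
have lnX (x : R) n : 0 < x -> ln (x ^+ n) = n%:R * ln x.
  by move=> x0; rewrite lnXn// mulr_natl.
have ln_rho : s * ln rho = - ln 2 by rewrite -ln_powR rhoXs lnV ?posrE.
pose sg := rho ^+ period.
have sg0 : 0 < sg by rewrite exprn_gt0.
have sg1 : sg < 1 by rewrite exprn_ilt1 ?ltW// -lt0n expn_gt0.
have a1 : 0 < 1 + `|a| by rewrite ltr_wpDr.
(* Going [c] periods deeper absorbs the constant [2 * 3 * (1 + |a|)] and the ratio [sg] between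
   consecutive scales. *)
have [c hc] : exists c, sg ^+ c < sg / (6 * (1 + `|a|)).
  by apply: rhoX_small => //; rewrite divr_gt0// mulr_gt0.
pose Q := (2 * period.-1 * c)%N.
(* Giving up half of the gain [1 / P] leaves room for the [c] extra periods once [q >= Q]. *)
apply: (@le_lt_trans _ _ (s * (1 - (2 * P)^-1))%:E); last first.
  rewrite lte_fin gtr_pMr// ltrBlDr ltrDl invr_gt0; lra.
(* The upper limit is an infimum over neighbourhoods; this one forces [q >= Q] below. *)
apply: ge_ereal_inf; eexists; first exists [set d : R | 0 < d < sg ^+ Q.+1] => //.
  near=> d; rewrite /=; apply/andP; split; near: d.
    exact: nbhs_right_gt.
  by apply: nbhs_right_lt; rewrite exprn_gt0.
apply: ge_ereal_sup => _ [d /andP[d0 dQ] <-].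
have d1 : d < 1.
  by apply: lt_le_trans dQ _; rewrite exprn_ile1 ?ltW.
have [||q /andP[qd dq]] := @geometric_scale _ sg d; first by rewrite sg0.
  by rewrite d0 ltW.
have Qq : (Q <= q)%N.
  rewrite leqNgt; apply/negP => qQ; have := lt_trans qd dQ.
  rewrite ltr_iXn2l// => ?; lia.
have cov : (covering_number d (pi_proj a @` E) <= (2 ^+ (period.-1 * (q + c)))%:E)%E.
  apply: covering_number_proj => //; rewrite exprM -/sg exprD.
  move: hc; rewrite ltr_pdivlMr ?mulr_gt0// => hc.
  have := ler_wpM2l (exprn_ge0 q (ltW sg0)) (ltW hc).
  by move: qd; rewrite exprSr; nra.
have lnd : 0 < - ln d by rewrite oppr_gt0 ln_lt0// d0.
apply: (@le_trans _ _ ((ln (2 ^+ (period.-1 * (q + c))))%:E * (- ln d)^-1%:E)%E).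
  apply: lee_wpmul2r; first by rewrite lee_fin invr_ge0 ltW.
  have p0 : 0 < 2 ^+ (period.-1 * (q + c)) :> R by rewrite exprn_gt0.
  rewrite -lne_EFin//.
  rewrite lee_lne//.
    by rewrite in_itv/= leey covering_number_ge0.
  by rewrite in_itv/= leey lee_fin ltW.
rewrite -EFinM lee_fin ler_pdivrMr// lnX// natrM natrD.
have s_lnd : q%:R * P * ln 2 <= s * - ln d.
  have : ln d <= ln (sg ^+ q) by rewrite ler_ln ?posrE// exprn_gt0.
  rewrite /sg -exprM lnX// natrM -/P => h.
  have := ler_wpM2l (ltW s_gt0) h.
  rewrite mulrCA ln_rho; lra.
have PE : period.-1%:R = P - 1 :> R.
  by rewrite -subn1 natrB ?expn_gt0.
rewrite PE.
have qQ : 2 * (P - 1) * c%:R <= q%:R.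
  by move: Qq; rewrite -(ler_nat R) /Q !natrM PE.
rewrite [leRHS]mulrAC; apply: le_trans (ler_wpM2r _ s_lnd); last first.
  by rewrite subr_ge0 invf_le1; lra.
(* After cancelling [ln 2], the claim is [(P - 1) * (q + c) <= q * (P - 1/2)], which is equivalent
   to [qQ]. *)
rewrite [leRHS]mulrAC ler_pM2r//.
have -> : q%:R * P * (1 - (2 * P)^-1) = q%:R * (P - 2^-1).
  by field; lra.
by nra.
Unshelve. all: by end_near. Qed.

End box_dimension.

(** * Unit vectors in the kernels of the projections *)

Section directions.
Variables (R : realType) (r : nat -> R).

(* The [2]-adic valuation takes each value [k] once in every block of
   [2 ^ k.+1] consecutive integers. *)
Definition direction (n : nat) : R * R :=
  let a := r (logn 2 n.+1) in (Num.max 1 `|a|)^-1 *: (- a, 1).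

Lemma norm_direction n : `|direction n| = 1.
Proof.
rewrite /direction; set a := r _; have m0 : 0 < Num.max 1 `|a| by rewrite lt_max ltr01.
rewrite normrZ prod_normE /= normrN normr1 normfV (gtr0_norm m0) maxC.
by rewrite mulVf// gt_eqF.
Qed.

Lemma pi_proj_direction k n : logn 2 n.+1 = k -> pi_proj (r k) (direction n) = 0.
Proof. by move=> <-; rewrite /direction pi_projZ /pi_proj /= mulr1 addNr mulr0. Qed.

End directions.

(** * Choice of the ratio and assembly of the set *)

Unset Implicit Arguments.

Theorem theorem1p4 (R : realType) (s : R) (r : nat -> R) (hs : 0 < s <= 1) :
  exists E : set (R * R),
    [/\ E !=set0, Ahlfors_regular s E
      & forall k : nat, (upper_box_dim (pi_proj (r k) @` E) < s%:E)%E].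
Proof.
have [s0 s1] := andP hs.
pose rho : R := 2^-1 `^ s^-1.
have rho0 : 0 < rho by rewrite powR_gt0// invr_gt0.
(* Here [s <= 1] enters, through [s^-1 >= 1]. *)
have rho_le : rho <= 2^-1.
  rewrite -[leRHS]powRr1 ?invr_ge0//; apply: ger_powR; first by lra.
  by rewrite invf_ge1.
have rhoXs : rho `^ s = 2^-1.
  by rewrite -powRrM mulVf ?gt_eqF// powRr1 ?invr_ge0.
have rho1 : rho < 1 by lra.
have v1 := norm_direction r.
have [f f_bsum] := bsum_limit_exists rho0 rho_le v1.
have mI : measurable (`[0, 1[%classic : set (measurableTypeR R)).
  exact: measurable_itv.
pose leb : {measure set (measurableTypeR R) -> \bar R} := mrestr lebesgue_measure mI.
have [mu muE] := pushforward_measure_exists leb (measurable_coding rho0 rho1 f_bsum).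
have {}muE A : mu A = lebesgue_measure (f @^-1` A `&` `[0%R, 1%R[%classic) by rewrite muE.
have radon : is_Radon mu.
  apply: tight_is_Radon => [|B mB e e0].
    rewrite muE preimage_setT setTI lebesgue_measure_itv/= lte_fin ltr01.
    by rewrite -EFinB ltry.
  have [K [cK KB BK]] := coding_tight rho0 rho1 f_bsum mB e0.
  by exists K; rewrite muE.
exists (spt mu); split.
- exists (f 0); apply: (coding_in_spt s0 rho0 rho_le rhoXs f_bsum muE).
  by rewrite lexx ltr01.
- exact: (Ahlfors_regular_spt s0 rho0 rho_le v1 rhoXs f_bsum muE radon).
- move=> k; apply: (@upper_box_dim_proj_lt _ s rho (direction r) _ _ _ _ _ _ k) => //.
  + by rewrite rho0.
  (* The constant 3 is 1 for approximating [x] by some [f t] plus 2 for truncating [f t]. *)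
  + move=> x N xE.
    have [t [_ xt]] := spt_near_coding muE xE (exprn_gt0 N rho0).
    exists (dyadic_index N t); apply: le_trans (ler_distD (f t) _ _) _.
    by have := f_bsum N t; lra.
  + exact: pi_proj_direction.
Qed.
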